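(* Let $n\geqslant 1$, let $\phi\colon\{0,1\}^n\to\{0,1\}$ be the structure function of an $n$-component semicoherent system, and let the component lifetimes $X_1,\ldots,X_n$ have an absolutely continuous joint c.d.f. (they may be dependent). Let $T$ be the system lifetime, let $q$ be the relative quality function associated with $X_1,\ldots,X_n$, and let $p_k=\Pr(T=X_{k:n})$. Then for every $k\in[n]$, $$ p_k=\sum_{\substack{\mathbf{x}\in\{0,1\}^n\\ |\mathbf{x}|=n-k+1}}q(\mathbf{x})\,\phi(\mathbf{x})-\sum_{\substack{\mathbf{x}\in\{0,1\}^n\\ |\mathbf{x}|=n-k}}q(\mathbf{x})\,\phi(\mathbf{x}). $$
   Context: Notation: $[n]=\{1,\ldots,n\}$ and $|\mathbf{x}|=\sum_{i=1}^n x_i$ for $\mathbf{x}\in\{0,1\}^n$. Elements $\mathbf{x}\in\{0,1\}^n$ are identified with subsets $S=\{i: x_i=1\}$ of $[n]$, so a function on $2^{[n]}$ is also regarded as a function on $\{0,1\}^n$ and vice versa. Semicoherent system: its structure function $\phi\colon\{0,1\}^n\to\{0,1\}$ (giving the state of the system in terms of the states of its components) is nondecreasing in each variable and satisfies $\phi(0,\ldots,0)=0$, $\phi(1,\ldots,1)=1$. Lifetimes: $X_1,\ldots,X_n$ are nonnegative random variables on a common probability space, $X_i$ being the lifetime of component $i$; their order statistics are $X_{1:n}\leqslant\cdots\leqslant X_{n:n}$ (the variables rearranged in ascending order). The joint c.d.f. is $F(t_1,\ldots,t_n)=\Pr(X_1\leqslant t_1,\ldots,X_n\leqslant t_n)$.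 The system lifetime is $T=\max_{1\leqslant j\leqslant m}\min_{i\in P_j}X_i$, where $P_1,\ldots,P_m$ are the minimal path sets of the system, i.e. the inclusion-minimal subsets $P\subseteq[n]$ with $\phi(P)=1$. Relative quality function: $q\colon 2^{[n]}\to[0,1]$ is defined by $q(S)=\Pr\big(\max_{i\in[n]\setminus S}X_i<\min_{j\in S}X_j\big)$, with the convention $q(\varnothing)=q([n])=1$. *)

(* Defs.v *)
(* Probability, measure and integration are those of MathComp-Analysis. *)
From HB Require Import structures.
From mathcomp Require Import all_boot all_order all_algebra.
From mathcomp Require Import all_classical all_reals all_analysis.

Set Implicit Arguments.
Unset Strict Implicit.
Unset Printing Implicit Defensive.

Import Order.TTheory GRing.Theory Num.Theory.
Import numFieldNormedType.Exports.

Local Open Scope classical_set_scope.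
Local Open Scope ring_scope.

(* Components are indexed by 'I_n = {0, ..., n-1} instead of {1, ..., n};
   {0,1}^n is {ffun 'I_n -> bool}. *)

Section Systems.
Variable n : nat.
Implicit Types (x y : {ffun 'I_n -> bool}) (S : {set 'I_n}).

Definition support_of x : {set 'I_n} := [set i | x i]%SET.

Definition indicator S : {ffun 'I_n -> bool} := [ffun i => i \in S].

Definition weight x : nat := (\sum_(i < n) x i)%N.

Definition semicoherent (phi : {ffun 'I_n -> bool} -> bool) : Prop :=
  [/\ forall (i : 'I_n) x y, (forall j, j != i -> x j = y j) ->
        (x i <= y i)%N -> (phi x <= phi y)%N,
      phi [ffun=> false] = false &
      phi [ffun=> true] = true].

Definition minimal_path_set (phi : {ffun 'I_n -> bool} -> bool) S : bool :=
  minset (fun S' => phi (indicator S')) S.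

End Systems.

(* Lebesgue measure on R^n, by induction on n: the unit mass on R^0, then the
   product of the measures on R and R^n, carried to R^(n+1) by
   (t, u) |-> t :: u. *)
Section LebesgueTuple.
Variable R : realType.

Definition tuple_cons n (p : measurableTypeR R * n.-tuple (measurableTypeR R)) :
  n.+1.-tuple (measurableTypeR R) := [tuple of p.1 :: p.2].

Lemma measurable_tuple_cons n : measurable_fun setT (@tuple_cons n).
Proof. exact: measurable_cons. Qed.

Section Step.
Variables (n : nat)
  (m : {sigma_finite_measure set (n.-tuple (measurableTypeR R)) -> \bar R}).

Definition lebesgue_step : set (n.+1.-tuple (measurableTypeR R)) -> \bar R :=
  pushforward (lebesgue_measure \x m)%E (@tuple_cons n).

Let lebesgue_step0 : lebesgue_step set0 = 0%E.
Proof. by rewrite /lebesgue_step /pushforward preimage_set0 measure0. Qed.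

Let lebesgue_step_ge0 A : (0 <= lebesgue_step A)%E.
Proof. exact: (measure_ge0 (lebesgue_measure \x m)%E). Qed.

Let lebesgue_step_additive : semi_sigma_additive lebesgue_step.
Proof.
exact: (@measure_semi_sigma_additive _ _ _
  (measure_function_pushforward__canonical__measure_function_Measure
     (lebesgue_measure \x m)%E (@measurable_tuple_cons n))).
Qed.

HB.instance Definition _ := isMeasure.Build _ _ _ lebesgue_step
  lebesgue_step0 lebesgue_step_ge0 lebesgue_step_additive.

Let lebesgue_step_sigma_finite : sigma_finite setT lebesgue_step.
Proof.
have /sigma_finiteP[F [UF ndF Foo]] := sigma_finiteT (@lebesgue_measure R).
have /sigma_finiteP[G [UG ndG Goo]] := sigma_finiteT m.
exists (fun i => [set t | F i (thead t) /\ G i [tuple of behead t]]).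
  apply/seteqP; split=> // t _.
  have : setT (thead t) by [].
  have : setT ([tuple of behead t] : n.-tuple (measurableTypeR R)) by [].
  rewrite UF UG => -[i _ Gi] [j _ Fj]; exists (maxn i j) => //; split.
    by apply: (subsetPset _ _ (ndF _ _ (leq_maxr i j))) Fj.
  by apply: (subsetPset _ _ (ndG _ _ (leq_maxl i j))) Gi.
move=> i; have [mF Fi] := Foo i; have [mG Gi] := Goo i; split.
  apply: measurableI; rewrite -[X in measurable X]setTI.
    exact: (measurable_tnth (ord0 : 'I_n.+1)).
  exact: (measurable_behead (n := n)).
rewrite /lebesgue_step /pushforward (_ : _ @^-1` _ = F i `*` G i).
  by rewrite product_measure1E// lte_mul_pinfty// ge0_fin_numE.
have headE p : thead (tuple_cons p) = p.1 by rewrite /thead tnth0.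
have beheadE p : [tuple of behead (tuple_cons p)] = p.2 :> n.-tuple _.
  exact: val_inj.
by rewrite /preimage; apply/seteqP; split=> p /=; rewrite headE beheadE.
Qed.

HB.instance Definition _ := Measure_isSigmaFinite.Build _ _ _ lebesgue_step
  lebesgue_step_sigma_finite.

End Step.

Fixpoint lebesgue_tuple n :
    {sigma_finite_measure set (n.-tuple (measurableTypeR R)) -> \bar R} :=
  match n with
  | 0%N => \d_([tuple] : 0.-tuple (measurableTypeR R))
  | n'.+1 => lebesgue_step (lebesgue_tuple n')
  end.

End LebesgueTuple.

Section Lifetimes.
Variables (n : nat) (d : measure_display) (Omega : measurableType d)
  (R : realType) (P : probability Omega R) (X : 'I_n -> {RV P >-> R}).

Definition joint_cdf (t : n.-tuple (measurableTypeR R)) : \bar R :=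
  P [set w | forall i, X i w <= tnth t i].

Definition absolutely_continuous_cdf : Prop :=
  exists f : n.-tuple (measurableTypeR R) -> R,
    [/\ measurable_fun setT f,
        forall u, 0 <= f u &
        forall t, joint_cdf t =
          (\int[lebesgue_tuple R n]_(u in [set u | forall i, (tnth u i <= tnth t i)%R])
             (f u)%:E)%E].

(* X_{k:n} for 1 <= k <= n *)
Definition order_statistic (k : nat) (w : Omega) : R :=
  nth 0 (sort <=%R [seq X i w | i <- enum 'I_n]) k.-1.

(* Maxima and minima are taken in the extended reals, those over the empty set
   being -oo and +oo; neither occurs in the lifetime of a semicoherent system,
   whose path sets are nonempty. *)
Definition system_lifetime (phi : {ffun 'I_n -> bool} -> bool) (w : Omega) :
    \bar R :=
  \big[maxe/-oo%E]_(S : {set 'I_n} | minimal_path_set phi S)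
    \big[mine/+oo%E]_(i in S) (X i w)%:E.

(* The convention q(set0) = q([n]) = 1 results from the values of the empty
   maximum and minimum: see relative_quality0 and relative_qualityT. *)
Definition relative_quality (S : {set 'I_n}) : R :=
  fine (P [set w | (\big[maxe/-oo]_(i in ~: S) (X i w)%:E <
                    \big[mine/+oo]_(j in S) (X j w)%:E)%E]).

Lemma relative_quality0 : relative_quality finset.set0 = 1.
Proof.
rewrite /relative_quality [X in P X](_ : _ = setT) ?probability_setT//.
apply/seteqP; split=> // w _ /=; rewrite finset.big_set0.
by elim/big_ind: _ => [|a b aoo boo|i _]; rewrite ?gt_max ?aoo ?ltNyr ?ltry.
Qed.

Lemma relative_qualityT : relative_quality finset.setT = 1.
Proof.
rewrite /relative_quality [X in P X](_ : _ = setT) ?probability_setT//.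
apply/seteqP; split=> // w _ /=; rewrite finset.setCT finset.big_set0.
by elim/big_ind: _ => [|a b aoo boo|i _]; rewrite ?lt_min ?aoo ?ltNyr ?ltNyr.
Qed.

Definition prob_lifetime_order_statistic
    (phi : {ffun 'I_n -> bool} -> bool) (k : nat) : R :=
  fine (P [set w | system_lifetime phi w = (order_statistic k w)%:E]).

End Lifetimes.

(* Main.v *)
Require Import Defs.
From HB Require Import structures.
From mathcomp Require Import all_boot all_order all_algebra.
From mathcomp Require Import all_classical all_reals all_analysis.
From mathcomp Require Import measurable_realfun zify.

Import Order.TTheory GRing.Theory Num.Theory.
Import numFieldNormedType.Exports.

Local Open Scope classical_set_scope.
Local Open Scope ring_scope.

(** As long as no two lifetimes coincide, there is for each [m <= n] exactly one
    set of [m] components that outlive all the others; and [T] exceeds a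
    threshold [c] exactly when the components outliving [c] contain a path set.
    Taking [c = X_{k:n}], the system fails at [X_{k:n}] if and only
    if the [n - k + 1] longest-lived components form a working system while the
    [n - k] longest-lived ones do not (lifetime_order_statisticE).  Let [A_m] be
    the event that the [m] longest-lived components work (top_works).  Then
    [A_{n-k}] is contained in [A_{n-k+1}] because [phi] is nondecreasing, hence
    [p_k = P A_{n-k+1} - P A_{n-k}].

    The event [A_m] is the disjoint union, over the [S] of cardinality [m] with
    [phi S = 1], of the events that every component of [S] outlives every
    component outside [S].  The latter have probability [q S], which makes
    [P A_m] the sum of [q x * phi x] over [|x| = m] (sum_relative_quality).

    Absolute continuity serves to discard ties.  Orthants form a pi-system that
    generates the Borel sets of R^n, so the identity between the c.d.f. and the
    integrals of the density over orthants extends to all Borel sets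
    (eq_measure_orthant); a tie then has probability zero because hyperplanes
    [u_i = u_j] are Lebesgue-null (lebesgue_tuple_tie).

    All the events involved depend only on the truth values of the finitely many
    comparisons [X_i <= X_j], whence their measurability
    (measurable_order_event). *)

Set Implicit Arguments.
Unset Strict Implicit.

(** * Hyperplanes of ties are Lebesgue-null *)

Lemma measurable_tie (R : realType) n (i j : 'I_n) :
  measurable [set u : n.-tuple (measurableTypeR R) | tnth u i = tnth u j].
Proof.
have : measurable_fun [set: n.-tuple (measurableTypeR R)]
    (fun u => tnth u i == tnth u j).
  by apply: measurable_fun_eqr; exact: measurable_tnth.
move=> /(_ measurableT [set true]); rewrite setTI => /(_ I).
by congr measurable; apply/seteqP; split=> u /= /eqP.
Qed.

Lemma lebesgue_tupleS (R : realType) n A :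
  lebesgue_tuple R n.+1 A =
  (@lebesgue_measure R \x lebesgue_tuple R n)%E (@tuple_cons R n @^-1` A).
Proof. by []. Qed.

(** By induction on the dimension.  If both coordinates lie in the tail, every
    section along the head is null by induction.  If one of them is the head,
    the measure is computed in the other order: once the tail is fixed, the
    head ranges over a single point. *)
Lemma lebesgue_tuple_tie (R : realType) n (i j : 'I_n) : i != j ->
  lebesgue_tuple R n [set u | tnth u i = tnth u j] = 0%E.
Proof.
elim: n i j => [[]//|n IHn] i j.
have mtie (k l : 'I_n.+1) : measurable
    (@tuple_cons R n @^-1` [set u | tnth u k = tnth u l]).
  rewrite -[X in measurable X]setTI.
  by apply: measurable_tuple_cons => //; exact: measurable_tie.
have tie0 (l : 'I_n) : lebesgue_tuple R n.+1
    [set u | tnth u ord0 = tnth u (lift ord0 l)] = 0%E.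
  rewrite lebesgue_tupleS.
  rewrite (product_measure_unique
    (m' := (lebesgue_measure \x^ lebesgue_tuple R n)%E))//; last first.
    exact: product_measure2E.
  rewrite /product_measure2; apply: integral0_eq => u _ /=.
  rewrite -[RHS](lebesgue_measure_set1 (tnth u l)); congr lebesgue_measure.
  apply/seteqP; split=> t; rewrite /ysection /= inE /=.
    by rewrite tnthS.
  by move=> ->; rewrite tnthS.
case: (unliftP ord0 i) => [i' ->|->]; case: (unliftP ord0 j) => [j' ->|->] //.
- rewrite (inj_eq (@lift_inj _ _)) => /IHn ij0.
  rewrite lebesgue_tupleS; apply: integral0_eq => t _ /=.
  rewrite -[RHS]ij0; congr (lebesgue_tuple R n _).
  by apply/seteqP; split=> u; rewrite /xsection /= inE /= !tnthS.
- move=> _; rewrite -[RHS](tie0 i'); congr (lebesgue_tuple R _ _).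
  by apply/seteqP; split=> u /= ->.
Qed.

(** * Orthants determine a finite measure on R^n *)

Definition orthant (R : realType) n (t : n.-tuple (measurableTypeR R)) :
    set (n.-tuple (measurableTypeR R)) :=
  [set u | forall i, tnth u i <= tnth t i].

Lemma measurable_orthant (R : realType) n (t : n.-tuple (measurableTypeR R)) :
  measurable (orthant t).
Proof.
rewrite (_ : orthant t = \bigcap_(i in setT) [set u | tnth u i <= tnth t i]).
  apply: fin_bigcap_measurable => // i _.
  have := @measurable_tnth _ (measurableTypeR R) n i measurableT _
    (measurable_itv `]-oo, tnth t i]).
  by rewrite setTI; congr measurable; apply/seteqP; split=> u; rewrite /= in_itv.
by apply/seteqP; split=> u /= H i; [move=> _|]; exact: H.
Qed.

Lemma orthantsI (R : realType) n : setI_closed (range (@orthant R n)).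
Proof.
move=> _ _ [s _ <-] [t _ <-].
exists [tuple Order.min (tnth s i) (tnth t i) | i < n] => //.
apply/seteqP; split=> u /=.
  by move=> H; split=> i; have := H i; rewrite tnth_mktuple le_min => /andP[].
by move=> [us ut] i; rewrite tnth_mktuple le_min us ut.
Qed.

Definition constant_tuple (R : realType) n (k : nat) :
    n.-tuple (measurableTypeR R) :=
  [tuple k%:R | i < n].

Lemma exists_orthant_constant (R : realType) n
    (u : n.-tuple (measurableTypeR R)) :
  exists k, orthant (constant_tuple R n k) u.
Proof.
have xk (x : R) : x <= (Num.truncn `|x|).+1%:R.
  by rewrite (le_trans (ler_norm _))// ltW// truncnS_gt.
exists (\max_(i < n) (Num.truncn `|tnth u i|).+1)%N => i.
rewrite tnth_mktuple (le_trans (xk _))// ler_nat.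
exact: (leq_bigmax (F := fun i => (Num.truncn `|tnth u i|).+1)).
Qed.

(** A half-space [u_i <= x] is the increasing union of the orthants whose vertex
    has [i]-th coordinate [x] and all others equal to [k]; half-spaces make the
    coordinates measurable. *)
Lemma orthants_generate (R : realType) n :
  @measurable _ (n.-tuple (measurableTypeR R)) = <<s range (@orthant R n) >>.
Proof.
apply/seteqP; split; last first.
  apply: smallest_sub; first exact: sigma_algebra_measurable.
  by move=> _ [t _ <-]; exact: measurable_orthant.
pose T := g_sigma_algebraType (range (@orthant R n)).
have ray (i : 'I_n) (x : R) : measurable ([set u | tnth u i <= x] : set T).
  rewrite (_ : [set u | _] = \bigcup_k
     orthant [tuple if j == i then x else k%:R | j < n]).
    apply: bigcupT_measurable => k; apply: sub_sigma_algebra.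
    by eexists; [|reflexivity].
  apply/seteqP; split=> u /=.
    move=> uix; have [k uk] := exists_orthant_constant u.
    exists k => // j; rewrite tnth_mktuple; case: eqP => [->//|_].
    by have := uk j; rewrite tnth_mktuple.
  by move=> [k _ /(_ i)]; rewrite tnth_mktuple eqxx.
have mtnth (i : 'I_n) :
    measurable_fun [set: T] (fun u => tnth u i : measurableTypeR R).
  apply: (measurability _ (RGenOInfty.measurableE R)) => _ [_ [x ->] <-].
  rewrite setTI.
  have := measurableC (ray i x); congr measurable.
  by apply/seteqP; split=> u /=; rewrite in_itv/= andbT ltNge => /negP.
have mid : measurable_fun [set: T] (id : T -> n.-tuple (measurableTypeR R)).
  exact/measurable_fun_tnthP.
by move=> A mA; have := mid measurableT A mA; rewrite setTI.
Qed.

(** Uniqueness of measures on a generating pi-system: the orthants at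
    [(k, ..., k)] supply the exhaustion by sets of finite measure. *)
Lemma eq_measure_orthant (R : realType) n
    (m1 m2 : {measure set (n.-tuple (measurableTypeR R)) -> \bar R}) :
  (forall t, (m1 (orthant t) < +oo)%E) ->
  (forall t, m1 (orthant t) = m2 (orthant t)) ->
  forall A, measurable A -> m1 A = m2 A.
Proof.
move=> m1oo m12.
apply: (measure_unique _ (fun k => orthant (constant_tuple R n k))
  (orthants_generate R n)).
- exact: orthantsI.
- by move=> k; exists (constant_tuple R n k).
- apply/seteqP; split=> // u _.
  by have [k uk] := exists_orthant_constant u; exists k.
- by move=> _ [t _ <-].
- by move=> k; exact: m1oo.
Qed.

(** * Absolute continuity excludes ties *)

Section LifetimeTuple.
Variables (n : nat) (d : measure_display) (Omega : measurableType d).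
Variables (R : realType) (P : probability Omega R) (X : 'I_n -> {RV P >-> R}).

Definition lifetimes (w : Omega) : n.-tuple (measurableTypeR R) :=
  [tuple X i w | i < n].

Lemma measurable_lifetimes : measurable_fun setT lifetimes.
Proof.
apply/measurable_fun_tnthP => i.
rewrite (_ : _ \o _ = X i); last by apply/funext => w /=; rewrite tnth_mktuple.
(* The Borel structures of [R] and of [measurableTypeR R] have distinct displays
   but convertible sets of measurable sets. *)
by move=> _ A mA; have := @measurable_funPT _ _ _ _ (X i) measurableT A mA.
Qed.

End LifetimeTuple.

(** The proofs [mf] and [f0] are arguments so that the measure structure on
    [density_measure] can be inferred from the term alone. *)
Definition density_measure d (T : measurableType d) (R : realType)
    (mu : {measure set T -> \bar R}) (f : T -> R)
    (mf : measurable_fun setT f) (f0 : forall x, 0 <= f x) (A : set T) : \bar R :=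
  (\int[mu]_(x in A) (f x)%:E)%E.

Section DensityMeasure.
Variables (d : measure_display) (T : measurableType d) (R : realType).
Variables (mu : {measure set T -> \bar R}) (f : T -> R).
Variables (mf : measurable_fun setT f) (f0 : forall x, 0 <= f x).

Let nu := density_measure mu mf f0.

Let nu0 : nu set0 = 0%E. Proof. exact: integral_set0. Qed.

Let nu_ge0 A : (0 <= nu A)%E.
Proof. by apply: integral_ge0 => x _; rewrite lee_fin. Qed.

Let nu_additive : semi_sigma_additive nu.
Proof.
apply: semi_sigma_additive_nng_induced => [|x]; last by rewrite lee_fin.
exact/measurable_EFinP.
Qed.

HB.instance Definition _ := isMeasure.Build _ _ _ (density_measure mu mf f0)
  nu0 nu_ge0 nu_additive.

End DensityMeasure.

(** The law of the lifetimes is the measure of density [f], as the two agree on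
    orthants; it therefore vanishes on the Lebesgue-null set of ties. *)
Lemma tie_null n d (Omega : measurableType d) (R : realType)
    (P : probability Omega R) (X : 'I_n -> {RV P >-> R}) (i j : 'I_n) :
  absolutely_continuous_cdf X -> i != j -> P [set w | X i w = X j w] = 0%E.
Proof.
move=> [f [mf f0 cdfE]] ij.
pose tie := [set u : n.-tuple (measurableTypeR R) | tnth u i = tnth u j].
pose law := measure_function_pushforward__canonical__measure_function_Measure
  P (measurable_lifetimes X).
have lawE A : law A = P (lifetimes X @^-1` A) by [].
have law_orthant t : law (orthant t) = joint_cdf X t.
  rewrite lawE; congr (P _); apply/seteqP; split=> w /= H k.
    by have := H k; rewrite tnth_mktuple.
  by rewrite tnth_mktuple.
transitivity (law tie).
  rewrite lawE; congr (P _).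
  by apply/seteqP; split=> w; rewrite /tie /= !tnth_mktuple.
rewrite (eq_measure_orthant
  (m2 := density_measure (lebesgue_tuple R n) mf f0))//.
- rewrite /= /density_measure null_set_integral //.
  + exact: measurable_tie.
  + by apply/measurable_EFinP; exact: measurable_funTS.
  + exact: lebesgue_tuple_tie.
- move=> t; rewrite lawE (le_lt_trans (probability_le1 _ _)) ?ltry//.
  rewrite -[X in measurable X]setTI; apply: measurable_lifetimes => //.
  exact: measurable_orthant.
- by move=> t; rewrite law_orthant cdfE.
- exact: measurable_tie.
Qed.

(** * Path sets *)

Lemma support_ofK n (x : {ffun 'I_n -> bool}) : indicator (support_of x) = x.
Proof. by apply/ffunP => i; rewrite ffunE inE. Qed.

Lemma indicatorK n (S : {set 'I_n}) : support_of (indicator S) = S.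
Proof. by apply/setP => i; rewrite inE ffunE. Qed.

Lemma weightE n (x : {ffun 'I_n -> bool}) : weight x = #|support_of x|.
Proof.
rewrite /weight -sum1_card [RHS]big_mkcond.
by apply: eq_bigr => i _; rewrite inE; case: (x i).
Qed.

(** Monotonicity in each variable yields monotonicity for inclusion by adding
    the components of [B :\: A] one at a time. *)
Lemma semicoherent_mono n (phi : {ffun 'I_n -> bool} -> bool) (A B : {set 'I_n}) :
  semicoherent phi -> A \subset B -> phi (indicator A) -> phi (indicator B).
Proof.
move=> [mono _ _]; have [m] := ubnP #|(B :\: A)%SET|.
elim: m A => // m IHm A lt_m sAB phiA.
have [BA0|[i]] := set_0Vmem (B :\: A)%SET.
  suff -> : B = A by [].
  by apply/eqP; rewrite finset.eqEsubset sAB andbT -finset.setD_eq0 BA0.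
rewrite inE => /andP[iNA iB]; apply: (IHm (i |: A)%SET).
- move: lt_m; rewrite (cardsD1 i (B :\: A)%SET) !inE iNA iB add1n !ltnS.
  by rewrite finset.setDDl finset.setUC.
- by rewrite finset.subUset finset.sub1set iB.
have h : (forall j, j != i -> indicator A j = indicator (i |: A)%SET j).
  by move=> j /negbTE ji; rewrite !ffunE !inE ji.
have := mono i _ _ h; rewrite !ffunE (negbTE iNA) => /(_ isT).
by rewrite phiA; case: (phi _).
Qed.

Lemma minimal_path_setP n (phi : {ffun 'I_n -> bool} -> bool) (U : {set 'I_n}) :
  semicoherent phi ->
  reflect (exists2 S, minimal_path_set phi S & S \subset U) (phi (indicator U)).
Proof.
move=> phi_sc; apply: (iffP idP).
  move=> phiU.
  by have [S] := minset_exists (P := fun S => phi (indicator S)) phiU; exists S.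
by move=> [S /minsetp phiS SU]; exact: semicoherent_mono phiS.
Qed.

(** * The system lifetime along a fixed outcome *)

Section PointwiseLifetime.
Variables (n : nat) (phi : {ffun 'I_n -> bool} -> bool).
Hypothesis phi_sc : semicoherent phi.
Variables (d : measure_display) (Omega : measurableType d).
Variables (R : realType) (P : probability Omega R) (X : 'I_n -> {RV P >-> R}).
Implicit Types (w : Omega) (c : R).

Lemma le_system_lifetime c w :
  (c%:E <= system_lifetime X phi w)%E = phi (indicator [set i | c <= X i w]%SET).
Proof.
apply/bigmax_geP/(minimal_path_setP _ phi_sc) => [[//|[S mS]]|[S mS SU]].
  move=> /bigmin_geP[_ cX]; exists S => //; apply/fintype.subsetP => i /cX.
  by rewrite inE lee_fin.
right; exists S => //; apply/bigmin_geP; split; first exact: leey.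
by move=> i /(fintype.subsetP SU); rewrite inE lee_fin.
Qed.

Lemma lt_system_lifetime c w :
  (c%:E < system_lifetime X phi w)%E = phi (indicator [set i | c < X i w]%SET).
Proof.
apply/bigmax_gtP/(minimal_path_setP _ phi_sc) => [[//|[S mS]]|[S mS SU]].
  move=> /bigmin_gtP[_ cX]; exists S => //; apply/fintype.subsetP => i /cX.
  by rewrite inE lte_fin.
right; exists S => //; apply/bigmin_gtP; split; first exact: ltry.
by move=> i /(fintype.subsetP SU); rewrite inE lte_fin.
Qed.

Lemma system_lifetimeP c w : system_lifetime X phi w = c%:E <->
  phi (indicator [set i | c <= X i w]%SET) /\
  ~~ phi (indicator [set i | c < X i w]%SET).
Proof.
rewrite -le_system_lifetime -lt_system_lifetime -leNgt; split=> [->|[cT Tc]].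
  by rewrite lexx.
by apply/eqP; rewrite eq_le Tc cT.
Qed.

Lemma count_lifetimes (p : pred R) w :
  count p [seq X i w | i <- enum 'I_n] = #|[set i | p (X i w)]%SET|.
Proof.
rewrite count_map cardE -size_filter; congr size.
by rewrite enumT /enum_mem; apply: eq_filter => i; rewrite /= inE.
Qed.

Lemma order_statistic_le k c w : (1 <= k <= n)%N ->
  (order_statistic X k w <= c) = (k <= #|[set i | (X i w <= c)%R]%SET|)%N.
Proof.
move=> /andP[k1 kn]; rewrite -(count_lifetimes (<= c)) /order_statistic.
set s := map _ _; have ss := sort_le_sorted s.
rewrite -(seq.permP (permEl (perm_sort <=%R s))); case: leqP => [kc|ck].
  by apply: nth_count_le => //; rewrite prednK.
apply: lt_geF; apply: nth_count_gt => //.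
by rewrite size_sort size_map size_enum_ord prednK // kn andbT -ltnS prednK.
Qed.

Lemma order_statistic_lt k c w : (1 <= k <= n)%N ->
  (order_statistic X k w < c) = (k <= #|[set i | (X i w < c)%R]%SET|)%N.
Proof.
move=> /andP[k1 kn]; rewrite -(count_lifetimes (< c)) /order_statistic.
set s := map _ _; have ss := sort_le_sorted s.
rewrite -(seq.permP (permEl (perm_sort <=%R s))); case: leqP => [kc|ck].
  by apply: nth_count_lt => //; rewrite prednK.
apply: le_gtF; apply: nth_count_ge => //.
by rewrite size_sort size_map size_enum_ord prednK // kn andbT -ltnS prednK.
Qed.

(** The value of [X_{k:n}] is characterised by two counts, which turns every
    statement about the sorted sequence into one about comparisons. *)
Lemma order_statisticP k c w : (1 <= k <= n)%N ->
  order_statistic X k w = c <->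
  (#|[set i | (X i w < c)%R]%SET| < k <= #|[set i | (X i w <= c)%R]%SET|)%N.
Proof.
move=> kn; rewrite -order_statistic_le// ltnNge -order_statistic_lt// -leNgt.
by rewrite andbC -eq_le; split=> /eqP.
Qed.

Lemma order_statistic_attained k w : (1 <= k <= n)%N ->
  exists i, order_statistic X k w = X i w.
Proof.
move=> /andP[k1 kn]; rewrite /order_statistic; set s := map _ _.
have : nth 0 (sort <=%R s) k.-1 \in s.
  by rewrite -(mem_sort <=%R) mem_nth// size_sort size_map size_enum_ord prednK.
by move=> /mapP[i _ ->]; exists i.
Qed.

(** The event whose probability is [q S], without the extended reals. *)
Definition separates w (S : {set 'I_n}) : Prop :=
  forall i j, i \notin S -> j \in S -> X i w < X j w.

(** Two distinct sets of the same cardinality each have a component outside the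
    other; each of these two components would outlive the other one. *)
Lemma separates_inj w (S S' : {set 'I_n}) :
  separates w S -> separates w S' -> #|S| = #|S'| -> S = S'.
Proof.
move=> sepS sepS' SS'; apply/eqP; rewrite eqEcard SS' leqnn andbT.
apply/fintype.subsetP => i iS; apply: contraT => iS'.
have [j jS' jS] : exists2 j, j \in S' & j \notin S.
  apply/fintype.subsetPn; apply: contra iS' => S'S.
  by have /eqP -> : S' == S by rewrite eqEcard S'S SS' leqnn.
by have := lt_trans (sepS _ _ jS iS) (sepS' _ _ iS' jS'); rewrite ltxx.
Qed.

Lemma relative_qualityE S :
  relative_quality X S = fine (P [set w | separates w S]).
Proof.
rewrite /relative_quality; congr (fine (P _)); apply/seteqP; split=> w /=.
  move=> lt_mm i j iS jS.
  have iS' : i \in (~: S)%SET by rewrite inE.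
  rewrite -lte_fin (le_lt_trans _ (lt_le_trans lt_mm _))//.
    exact: (le_bigmax_cond _ (fun i => (X i w)%:E)).
  exact: (bigmin_le_cond _ (fun i => (X i w)%:E)).
move=> sep; apply/bigmax_ltP; split.
  by apply/bigmin_gtP; split=> // i _; exact: ltNyr.
move=> i; rewrite inE => iS; apply/bigmin_gtP; split; first exact: ltry.
by move=> j jS; rewrite lte_fin; exact: sep.
Qed.

(** The [m] longest-lived components form a working system.  With ties at the
    [m]-th place there may be no set of [m] longest-lived components, and the
    event then fails. *)
Definition top_works m : set Omega :=
  [set w | exists x, [/\ weight x = m, separates w (support_of x) & phi x]].

Lemma top_worksE w (S : {set 'I_n}) : separates w S ->
  top_works #|S| w <-> phi (indicator S).
Proof.
move=> sepS; split=> [[x [xS sepx phix]]|phiS].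
  by rewrite -(separates_inj sepx sepS) ?support_ofK// -weightE.
by exists (indicator S); rewrite weightE indicatorK.
Qed.

Definition untied w : Prop := forall i j, i != j -> X i w <> X j w.

(** For [c = X_{k:n}] the sets [c <= X_j] and [c < X_j] are separated from their
    complements.  The counts of order_statisticP bound their cardinalities by
    [n - k + 1] from below and [n - k] from above, and without ties they differ
    by exactly one element; so both bounds are attained. *)
Lemma top_works_untied k w (c := order_statistic X k w) :
  (1 <= k <= n)%N -> untied w ->
  (top_works (n - k + 1) w <-> phi (indicator [set i | c <= X i w]%SET)) /\
  (top_works (n - k) w <-> phi (indicator [set i | c < X i w]%SET)).
Proof.
move=> kn Xinj.
have [i ci] : exists i, c = X i w by exact: order_statistic_attained.
set U := [set j | c <= X j w]%SET; set V := [set j | c < X j w]%SET.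
have sepU : separates w U.
  by move=> j l; rewrite !inE -ltNge; exact: lt_le_trans.
have sepV : separates w V.
  by move=> j l; rewrite !inE -leNgt; exact: le_lt_trans.
have UV : U = (i |: V)%SET.
  apply/setP => j; rewrite !inE le_eqVlt; congr (_ || _).
  apply/eqP/eqP => [cj|->//]; apply/eqP; apply: contraT => /Xinj.
  by rewrite -cj ci.
have cU : #|U| = #|V|.+1 by rewrite UV cardsU1 inE ci ltxx.
have /(order_statisticP _ _ kn)/andP[ltk lek] : order_statistic X k w = c by [].
have cUV : #|(~: U)%SET| = #|[set j | (X j w < c)%R]%SET|.
  by apply: eq_card => j; rewrite !inE -ltNge.
have cV : #|(~: V)%SET| = #|[set j | (X j w <= c)%R]%SET|.
  by apply: eq_card => j; rewrite !inE -leNgt.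
have := cardsC U; have := cardsC V; rewrite card_ord cUV cV => nV nU.
have Vk : #|V| = (n - k)%N by lia.
by rewrite addn1 -Vk -cU !top_worksE.
Qed.

(** [T = c] means that the components lasting until [c] work and those lasting
    beyond [c] do not; for [c = X_{k:n}] these are the [n - k + 1] and the
    [n - k] longest-lived ones. *)
Lemma lifetime_order_statisticE k w : (1 <= k <= n)%N -> untied w ->
  system_lifetime X phi w = (order_statistic X k w)%:E <->
  top_works (n - k + 1) w /\ ~ top_works (n - k) w.
Proof.
move=> kn Xinj; have [-> ->] := top_works_untied kn Xinj.
by rewrite system_lifetimeP; split=> -[H /negP].
Qed.

Lemma top_worksS k w : (1 <= k <= n)%N -> untied w ->
  top_works (n - k) w -> top_works (n - k + 1) w.
Proof.
move=> kn Xinj; have [-> ->] := top_works_untied kn Xinj.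
apply: semicoherent_mono => //; apply/fintype.subsetP => i.
by rewrite !inE; exact: ltW.
Qed.

End PointwiseLifetime.

(** * Events determined by the order of the lifetimes *)

Section OrderEvents.
Variables (n : nat) (d : measure_display) (Omega : measurableType d).
Variables (R : realType) (P : probability Omega R) (X : 'I_n -> {RV P >-> R}).

(** Such an event is a finite union, over the possible comparison tables, of
    finite intersections of the measurable events fixing one comparison. *)
Lemma measurable_order_event (A : set Omega) :
  (forall w w', (forall i j, (X i w <= X j w) = (X i w' <= X j w')) ->
    A w -> A w') -> measurable A.
Proof.
move=> A_inv.
pose cmp w := [ffun p : 'I_n * 'I_n => X p.1 w <= X p.2 w].
rewrite (_ : A = \bigcup_(r in cmp @` A) \bigcap_(p in setT)
    [set w | (X p.1 w <= X p.2 w) = r p]).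
  apply: fin_bigcup_measurable => [|r _]; first exact: finite_finset.
  apply: fin_bigcap_measurable => [|p _]; first exact: finite_finset.
  have : measurable_fun setT (fun w => X p.1 w <= X p.2 w).
    by apply: measurable_fun_ler; exact: measurable_funPT.
  by move=> /(_ measurableT [set r p]); rewrite setTI; apply.
apply/seteqP; split=> [w Aw|w [_ [w' Aw' <-]] eq_cmp].
  by exists (cmp w); [exists w|move=> p _ /=; rewrite ffunE].
by apply: (A_inv w') => // i j; have := eq_cmp (i, j) I; rewrite /= ffunE.
Qed.

Lemma separates_inv w w' S :
  (forall i j, (X i w <= X j w) = (X i w' <= X j w')) ->
  separates X w S -> separates X w' S.
Proof. by move=> cmp sep i j iS jS; rewrite ltNge -cmp -ltNge; exact: sep. Qed.

Lemma measurable_separates S : measurable [set w | separates X w S].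
Proof. by apply: measurable_order_event => w w' /separates_inv; apply. Qed.

Lemma measurable_top_works phi m : measurable (top_works phi X m).
Proof.
apply: measurable_order_event => w w' cmp [x [xm sepx phix]].
by exists x; split=> //; exact: separates_inv sepx.
Qed.

(** [X_{k:n}] is one of the [X_i], and whether [X_i = X_{k:n}] and whether
    [T = X_i] are both decided by comparing [X_i] with the other lifetimes. *)
Lemma measurable_lifetime_order_statistic phi k :
  semicoherent phi -> (1 <= k <= n)%N ->
  measurable [set w | system_lifetime X phi w = (order_statistic X k w)%:E].
Proof.
move=> phi_sc kn; apply: measurable_order_event => w w' cmp /=.
have cmp_lt i j : (X i w < X j w) = (X i w' < X j w') by rewrite !ltNge cmp.
have [i ci] := order_statistic_attained X w kn.
have c'i : order_statistic X k w' = X i w'.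
  apply/order_statisticP => //; move/order_statisticP: ci => /(_ kn).
  under eq_finset do rewrite cmp_lt.
  by under [X in (_ <= #|pred_of_set X|)%N]eq_finset do rewrite cmp.
rewrite c'i ci !system_lifetimeP//.
under eq_finset do rewrite cmp.
by under [X in ~~ phi (indicator X)]eq_finset do rewrite cmp_lt.
Qed.

(** The union defining [top_works] is disjoint by separates_inj. *)
Lemma sum_relative_quality (phi : {ffun 'I_n -> bool} -> bool) m :
  \sum_(x : {ffun 'I_n -> bool} | weight x == m)
     relative_quality X (support_of x) * (phi x)%:R =
  fine (P (top_works phi X m)).
Proof.
pose D := [set x : {ffun 'I_n -> bool} | (weight x == m) && phi x].
rewrite (_ : top_works phi X m =
    \bigcup_(x in D) [set w | separates X w (support_of x)]); last first.
  apply/seteqP; split=> w.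
    by move=> [x [/eqP xm sepx phix]]; exists x => //; rewrite /D /= xm.
  by move=> [x /andP[/eqP xm phix] sepx]; exists x.
rewrite measure_fin_bigcup//; first last.
- by move=> x _; exact: measurable_separates.
- move=> x y /andP[/eqP xm _] /andP[/eqP ym _] [w [sepx sepy]].
  rewrite -(support_ofK x) -(support_ofK y); congr indicator.
  by apply: separates_inj sepx sepy _; rewrite -!weightE xm.
- exact: finite_finset.
rewrite /D -(@bigfs _ _ _ _ (index_enum _)) ?index_enum_uniq//; last first.
  by move=> x _; rewrite mem_index_enum.
rewrite -sum_fine; last first.
  by move=> x _; exact: fin_num_measure (measurable_separates _).
rewrite big_mkcondr; apply: eq_bigr => x _.
by rewrite relative_qualityE; case: (phi x); rewrite ?mulr1 ?mulr0.
Qed.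

Lemma eq_measure_off_null (A B N : set Omega) :
  measurable A -> measurable B -> measurable N -> P N = 0%E ->
  (forall w, ~ N w -> A w <-> B w) -> P A = P B.
Proof.
move=> mA mB mN N0 AB.
have PD C : measurable C -> P C = P (C `\` N).
  move=> mC; rewrite [LHS](measureDI P mC mN).
  rewrite [X in (_ + X)%E](_ : _ = 0%E) ?adde0//.
  apply: subset_measure0 N0 => //; exact: measurableI.
rewrite PD// [RHS]PD//; congr (P _); apply/seteqP.
by split=> w /= [ABw Nw]; split=> //; apply/(AB _ Nw).
Qed.

End OrderEvents.

Lemma untied_ae n d (Omega : measurableType d) (R : realType)
    (P : probability Omega R) (X : 'I_n -> {RV P >-> R}) :
  absolutely_continuous_cdf X ->
  exists N, [/\ measurable N, P N = 0%E & forall w, ~ N w -> untied X w].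
Proof.
move=> X_ac.
pose tie (p : 'I_n * 'I_n) := [set w | X p.1 w = X p.2 w].
have mtie p : measurable (tie p).
  apply: (measurable_order_event (X := X)) => w w' cmp /eqP tie_w.
  by apply/eqP; rewrite eq_le -!cmp -eq_le.
pose N := \big[setU/set0]_(p | p.1 != p.2) tie p.
have [mN N0] : measurable N /\ P N = 0%E.
  rewrite /N; elim/big_ind : _ => [|A B [mA A0] [mB B0]|p /(tie_null X_ac)//].
    by split; [exact: measurable0|exact: measure0].
  by split; [exact: measurableU|exact: null_set_setU].
exists N; split=> // w Nw i j ij Xij; apply: Nw.
by rewrite /N (bigD1 (i, j))//=; left.
Qed.

(** * The probability that the system fails at the k-th component failure *)

Unset Implicit Arguments.
Set Strict Implicit.

Theorem theorem2 (n : nat) (n_ge1 : (1 <= n)%N)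
    (phi : {ffun 'I_n -> bool} -> bool) (phi_semicoherent : semicoherent phi)
    (d : measure_display) (Omega : measurableType d) (R : realType)
    (P : probability Omega R) (X : 'I_n -> {RV P >-> R})
    (X_ge0 : forall i w, 0 <= X i w)
    (X_ac : absolutely_continuous_cdf X)
    (k : nat) (k_range : (1 <= k <= n)%N) :
  prob_lifetime_order_statistic X phi k =
    \sum_(x : {ffun 'I_n -> bool} | weight x == (n - k + 1)%N)
      relative_quality X (support_of x) * (phi x)%:R
  - \sum_(x : {ffun 'I_n -> bool} | weight x == (n - k)%N)
      relative_quality X (support_of x) * (phi x)%:R.
Proof.
rewrite !sum_relative_quality /prob_lifetime_order_statistic.
have [N [mN N0 untiedN]] := untied_ae X_ac.
have mE := measurable_lifetime_order_statistic X phi_semicoherent k_range.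
set A := top_works phi X (n - k + 1); set B := top_works phi X (n - k).
have mA : measurable A by exact: measurable_top_works.
have mB : measurable B by exact: measurable_top_works.
have mAB := measurableI _ _ mA mB.
rewrite (eq_measure_off_null mE (measurableD mA mB) mN N0); last first.
  by move=> w /untiedN; exact: lifetime_order_statisticE.
have <- : P (A `&` B) = P B.
  apply: (eq_measure_off_null mAB mB mN N0) => w /untiedN Xinj.
  split=> [[]//|Bw]; split=> //; exact: top_worksS Bw.
rewrite -fineB ?fin_num_measure//; congr fine.
by rewrite measureD// -ge0_fin_numE// fin_num_measure.
Qed.
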